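(* There is a universal constant $C$ such that for all integers $d\ge1$, $k\ge1$: $\mathbb{D}_{\mathrm{onl}}(\mathcal{H}_{k,d};\ell_\cap)\le Ck^2\log^4(edk)$. Consequently (via the characterization of the minimax realizable cumulative loss by $\mathbb D_{\mathrm{onl}}$), there is a deterministic online learner whose cumulative squared loss $\sum_t(\hat y_t-y_t)^2$ on every sequence realizable by $\mathcal{H}_{k,d}$ is $O(k^2\log^4(edk))$.
   Context: $\mathcal{X}=\{x\in[-1,1]^d:\|x\|_2\le1\}$, $\mathrm{clip}(z)=\max\{-1,\min\{1,z\}\}$, $\mathrm{ReLU}(z)=\max\{0,z\}$. $\mathcal{H}_{k,d}=\{x\mapsto\mathrm{clip}(\sum_{j=1}^ka_j\mathrm{ReLU}(w^j\cdot x)): a_j\in[-1,1],\ \|w^j\|_2\le1\}$. Clipped squared loss $\ell_\cap(\hat y,y)=\min\{1,(\hat y-y)^2/4\}$. Scaled Littlestone tree of depth $D\le\infty$: internal nodes $u\in\{0,1\}^{<D}$ labeled $x_u\in\mathcal X$, edges labeled $s_{u,0},s_{u,1}\in\mathbb R$, gap $\gamma_u=\ell_\cap(s_{u,0},s_{u,1})$; realizable by a class $\mathcal H$ if for every branch $b$ and finite $n\le D$ some $h\in\mathcal{H}$ has $h(x_{b_{\le t}})=s_{b_{\le t},b_{t+1}}$ for $t<n$ ($b_{\le t}$ the length-$t$ prefix). $\mathbb{D}_{\mathrm{onl}}(\mathcal{H};\ell_\cap)=\sup_{\mathcal T}\inf_b\sum_t\gamma_{b_{\le t}}$ over realizable trees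 and their branches. *)

(* Defs.v *)
From HB Require Import structures.
From mathcomp Require Import all_boot all_order all_algebra.
From mathcomp Require Import all_classical all_reals all_analysis.
Set Implicit Arguments. Unset Strict Implicit. Unset Printing Implicit Defensive.
Import Order.TTheory GRing.Theory Num.Theory.
Local Open Scope ring_scope.
Local Open Scope classical_set_scope.

Section Defs.
Variable R : realType.

Definition vec (d : nat) := 'I_d -> R.

Definition dotp d (w x : vec d) : R := \sum_(i < d) w i * x i.
Definition norm2 d (x : vec d) : R := Num.sqrt (\sum_(i < d) x i ^+ 2).

Definition domX d : set (vec d) :=
  [set x | (forall i, -1 <= x i <= 1) /\ norm2 x <= 1].

Definition clip (z : R) : R := Num.max (-1) (Num.min 1 z).
Definition relu (z : R) : R := Num.max 0 z.

Definition Hkd (k d : nat) : set (vec d -> R) :=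
  [set h | exists (a : 'I_k -> R) (w : 'I_k -> vec d),
     (forall j, -1 <= a j <= 1) /\ (forall j, norm2 (w j) <= 1) /\
     h = fun x => clip (\sum_(j < k) a j * relu (dotp (w j) x))].

Definition lcap (yh y : R) : R := Num.min 1 ((yh - y) ^+ 2 / 4).

(* Depth D <= oo : None stands for D = oo. *)
Definition depth := option nat.
Definition lt_depth (D : depth) (n : nat) : bool :=
  if D is Some m then (n < m)%N else true.
Definition le_depth (D : depth) (n : nat) : bool :=
  if D is Some m then (n <= m)%N else true.

Definition prefix (b : nat -> bool) (t : nat) : seq bool := mkseq b t.

(* A scaled Littlestone tree: node labels x_u, edge labels s_{u,0}, s_{u,1};
   nodes are bit strings u of length < D. *)
Definition gap (s : seq bool -> bool -> R) (u : seq bool) : R :=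
  lcap (s u false) (s u true).

Definition realizable_tree d (H : set (vec d -> R)) (D : depth)
  (x : seq bool -> vec d) (s : seq bool -> bool -> R) : Prop :=
  (forall u : seq bool, lt_depth D (size u) -> domX (x u)) /\
  (forall (b : nat -> bool) (n : nat), le_depth D n ->
     exists2 h, H h & forall t, (t < n)%N ->
       h (x (prefix b t)) = s (prefix b t) (b t)).

Definition branch_gain (D : depth) (s : seq bool -> bool -> R)
  (b : nat -> bool) : \bar R :=
  match D with
  | Some m => ((\sum_(t < m) gap s (prefix b t))%:E)%E
  | None => (\sum_(0 <= t <oo) (gap s (prefix b t))%:E)%E
  end.

Definition Donl d (H : set (vec d -> R)) : \bar R :=
  ereal_sup [set v | exists (D : depth) (x : seq bool -> vec d)
                        (s : seq bool -> bool -> R),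
     realizable_tree H D x s /\
     v = ereal_inf [set branch_gain D s b | b in [set: nat -> bool]]].

Definition learner d := seq (vec d * R) -> vec d -> R.

Definition history d (x : nat -> vec d) (y : nat -> R) (t : nat)
  : seq (vec d * R) := [seq (x i, y i) | i <- iota 0 t].

Definition cum_sq_loss d (L : learner d) (x : nat -> vec d) (y : nat -> R)
  (T : nat) : R :=
  \sum_(t < T) (L (history x y t) (x t) - y t) ^+ 2.

Definition realizable_seq d (H : set (vec d -> R)) (x : nat -> vec d)
  (y : nat -> R) (T : nat) : Prop :=
  (forall t, (t < T)%N -> domX (x t)) /\
  exists2 h, H h & forall t, (t < T)%N -> y t = h (x t).

Definition bound (k d : nat) : R :=
  (k%:R) ^+ 2 * (ln (expR 1 * d%:R * k%:R)) ^+ 4.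

End Defs.

(* Main.v *)
Require Import Defs.
From HB Require Import structures.
From mathcomp Require Import all_boot all_order all_algebra.
From mathcomp Require Import all_classical all_reals all_analysis.
From mathcomp Require Import ring lra zify.
Import Order.TTheory GRing.Theory Num.Theory.
Local Open Scope ring_scope.

(* A deterministic learner whose cumulative squared loss is at most B forces
   Donl <= B, so it suffices to build one learner with loss O(k^2 log^3(edk)).
   Learner 0 is conservative: it predicts clip(P) and updates only when its
   error g exceeds alpha = 1/poly(dk).  As clip is monotone and 1-Lipschitz,
   the sum of the g^2 is at most the sum of the g (P - F), the linear regret
   against the target network F, a sum of 2k functions +-relu(w.x) with
   |w| <= 1.  For each sign this regret is controlled by chaining: at scale
   2^-i every w.x is tracked within 2^-i by one of N^O(4^i) perceptron experts
   (indexed by their update rounds and signs), and exponential weights are run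
   on the differences of consecutive scales.  Each of O(log(dk)) scales costs
   the same, which gives sum g^2 = O(k^2 log^3(edk)).
   Errors below alpha are handled by halving over parameter grids at the scales
   alpha 2^-j: a mistake at scale j costs O(alpha^2 4^-j), while there are only
   O(dk (log(edk) + j)) of them.  The predictions are combined by projecting the
   finer ones onto the confidence intervals of the coarser ones. *)

(** * Exponential weights *)

Section OnlineLinear.
Context {R : realType} {X : Type}.
Implicit Types (h : seq (X * R)) (q : seq (X * R) -> X -> R).

(* Here a list h of rounds has the latest round first, whereas the [history] of
   a learner has it last. *)
Fixpoint cum q h : R :=
  if h is p :: h' then p.2 * q h' p.1 + cum q h' else 0.

Definition gsq h : R := \sum_(p <- h) p.2 ^+ 2.
Definition gabs h : R := \sum_(p <- h) `|p.2|.

(** A round pairs an input with the coefficient [g] of its linear loss; [P] sees it together with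
    the rounds before it, as an adaptive predictor does. *)
Fixpoint rounds (P : seq (X * R) -> X -> R -> Prop) h : Prop :=
  if h is p :: h' then P h' p.1 p.2 /\ rounds P h' else True.

Lemma rounds_impl (P Q : seq (X * R) -> X -> R -> Prop) h :
  (forall h' x g, P h' x g -> Q h' x g) -> rounds P h -> rounds Q h.
Proof. by move=> PQ; elim: h => //= p h IH [/PQ ? /IH]. Qed.

Lemma roundsI (P Q : seq (X * R) -> X -> R -> Prop) h :
  rounds P h -> rounds Q h ->
  rounds (fun h' x g => P h' x g /\ Q h' x g) h.
Proof. by elim: h => //= p h IH [? /IH{}IH] [? /IH]. Qed.

Lemma gsq_cons p h : gsq (p :: h) = p.2 ^+ 2 + gsq h.
Proof. by rewrite /gsq big_cons. Qed.

Lemma gabs_cons p h : gabs (p :: h) = `|p.2| + gabs h.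
Proof. by rewrite /gabs big_cons. Qed.

Lemma cum_sum (I : Type) (r : seq I) (q : I -> seq (X * R) -> X -> R) h :
  cum (fun h x => \sum_(i <- r) q i h x) h = \sum_(i <- r) cum (q i) h.
Proof.
elim: h => [|p h IH] /=; first by rewrite big1.
by rewrite IH big_split mulr_sumr.
Qed.

Lemma cumZ (c : R) q h : cum (fun h x => c * q h x) h = c * cum q h.
Proof. by elim: h => [|p h IH] /=; [rewrite mulr0 | rewrite IH; ring]. Qed.

Lemma cumD q1 q2 h :
  cum (fun h x => q1 h x + q2 h x) h = cum q1 h + cum q2 h.
Proof. by elim: h => [|p h IH] /=; [rewrite addr0 | rewrite IH; ring]. Qed.

Lemma cumB q1 q2 h :
  cum (fun h x => q1 h x - q2 h x) h = cum q1 h - cum q2 h.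
Proof. by elim: h => [|p h IH] /=; [rewrite subr0 | rewrite IH; ring]. Qed.

Lemma eq_cum q1 q2 h :
  rounds (fun h x _ => q1 h x = q2 h x) h -> cum q1 h = cum q2 h.
Proof. by elim: h => //= p h IH [-> /IH->]. Qed.

Lemma cum_close q1 q2 h (c : R) :
  rounds (fun h x _ => `|q1 h x - q2 h x| <= c) h ->
  cum q1 h <= cum q2 h + c * gabs h.
Proof.
elim: h => [|p h IH] /=; first by rewrite /gabs big_nil; lra.
move=> [le_c /IH{}IH]; rewrite gabs_cons.
suff : p.2 * q1 h p.1 - p.2 * q2 h p.1 <= c * `|p.2| by lra.
rewrite -mulrBr; apply: le_trans (ler_norm _) _.
by rewrite normrM mulrC ler_wpM2r.
Qed.

(* Replaces Hoeffding's lemma: applied to a centred variable it bounds the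
   exponential moment without any restriction on its size. *)
Lemma expR_le_addr_expR_sqr (x : R) : expR x <= x + expR (2 * x ^+ 2).
Proof.
(* Above 1/2 one has [x <= 2 * x ^+ 2]; below it, [expR x <= 1 / (1 - x) <= 1 + x + 2 * x ^+ 2]. *)
have [x12|x12] := leP x (1 / 2); last first.
  have : expR x <= expR (2 * x ^+ 2) by rewrite ler_expR; nra.
  lra.
have h1 := expR_ge1Dx (- x).
have h2 := expR_ge1Dx (2 * x ^+ 2).
have x0 : 0 < 1 - x by lra.
have : expR x * (1 - x) <= 1.
  rewrite -[leRHS](expRxMexpNx_1 x); apply: ler_wpM2l; first exact: expR_ge0.
  lra.
move=> h3; suff : expR x <= 1 + x + 2 * x ^+ 2 by lra.
rewrite -(ler_pM2r x0); apply: le_trans h3 _; nra.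
Qed.

Section Ewa.
Context {E : finType}.
Variables (eta r : R) (Q : E -> seq (X * R) -> X -> R).
Hypotheses (eta_gt0 : 0 < eta) (Q_le : forall e h x, `|Q e h x| <= r).

Definition ewa_weight h e : R := expR (- (eta * cum (Q e) h)).
Definition ewa h x : R :=
  (\sum_e ewa_weight h e * Q e h x) / \sum_e ewa_weight h e.

Lemma ewa_total_gt0 (e0 : E) h : 0 < \sum_e ewa_weight h e.
Proof.
rewrite (bigD1 e0) //= ltr_pwDl ?expR_gt0 //.
by apply: sumr_ge0 => e _; exact: expR_ge0.
Qed.

Lemma ewa_le (e0 : E) h x : `|ewa h x| <= r.
Proof.
have W0 := ewa_total_gt0 e0 h.
rewrite /ewa normrM normfV (gtr0_norm W0) ler_pdivrMr // mulr_sumr.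
apply: le_trans (ler_norm_sum _ _ _) _; apply: ler_sum => e _.
by rewrite normrM ger0_norm ?expR_ge0 // mulrC ler_wpM2r ?expR_ge0.
Qed.

(** Under the weights, [Q e] is centred at [ewa], so the first-order term of the exponential bound
    sums to zero. The deviations are at most [2 * r], whence the constant 8. *)
Lemma ewa_total_cons (e0 : E) h (p : X * R) :
  \sum_e ewa_weight (p :: h) e <=
  (\sum_e ewa_weight h e) *
    expR (- (eta * (p.2 * ewa h p.1)) + 8 * eta * r ^+ 2 * eta * p.2 ^+ 2).
Proof.
have W0 := ewa_total_gt0 e0 h.
have le_e e : ewa_weight (p :: h) e <= ewa_weight h e *
    (expR (- (eta * (p.2 * ewa h p.1))) *
      (- (eta * p.2 * (Q e h p.1 - ewa h p.1)) +
       expR (8 * eta * r ^+ 2 * eta * p.2 ^+ 2))).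
  rewrite /ewa_weight /=.
  have -> : - (eta * (p.2 * Q e h p.1 + cum (Q e) h)) =
    - (eta * cum (Q e) h) + (- (eta * (p.2 * ewa h p.1)) +
      - (eta * p.2 * (Q e h p.1 - ewa h p.1))) by ring.
  rewrite !expRD; apply: ler_wpM2l; first exact: expR_ge0.
  apply: ler_wpM2l; first exact: expR_ge0.
  apply: le_trans (expR_le_addr_expR_sqr _) _.
  rewrite lerD2l ler_expR sqrrN exprMn.
  have -> : 8 * eta * r ^+ 2 * eta * p.2 ^+ 2 =
    2 * ((eta * p.2) ^+ 2 * (2 * r) ^+ 2) by ring.
  rewrite ler_pM2l // ler_wpM2l ?sqr_ge0 //.
  have := Q_le e h p.1; have := ewa_le e0 h p.1; rewrite !ler_norml.
  move=> /andP[? ?] /andP[? ?].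
  nra.
apply: le_trans (ler_sum _ (fun e _ => le_e e)) _.
rewrite (eq_bigr (fun e => expR (- (eta * (p.2 * ewa h p.1))) *
   (- (eta * p.2) * (ewa_weight h e * Q e h p.1) +
     (eta * p.2 * ewa h p.1 + expR (8 * eta * r ^+ 2 * eta * p.2 ^+ 2)) *
        ewa_weight h e))); last by move=> e _; ring.
rewrite -mulr_sumr big_split /= -!mulr_sumr.
have -> : \sum_e ewa_weight h e * Q e h p.1 =
  ewa h p.1 * \sum_e ewa_weight h e.
  by rewrite /ewa divfK // gt_eqF.
rewrite expRD le_eqVlt; apply/orP; left; apply/eqP; ring.
Qed.

(** Potential argument: the total weight starts at [#|E|], shrinks with the loss of [ewa], and
    always dominates the weight of the single expert [e]. *)
Lemma ewa_regret (e : E) h :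
  cum ewa h - cum (Q e) h <= ln (#|E|%:R) / eta + 8 * eta * r ^+ 2 * gsq h.
Proof.
have total_le : \sum_e ewa_weight h e <=
    #|E|%:R * expR (- (eta * cum ewa h) + 8 * eta * r ^+ 2 * eta * gsq h).
  elim: h => [|p h IH].
    rewrite (eq_bigr (fun=> 1)); last first.
      by move=> e' _; rewrite /ewa_weight /= mulr0 oppr0 expR0.
    by rewrite sumr_const /= /gsq big_nil !mulr0 oppr0 addr0 expR0 mulr1.
  apply: le_trans (ewa_total_cons e h p) _.
  have := ler_wpM2r (expR_ge0 (- (eta * (p.2 * ewa h p.1)) +
    8 * eta * r ^+ 2 * eta * p.2 ^+ 2)) IH.
  move/le_trans; apply; rewrite gsq_cons /=.
  have -> : - (eta * (p.2 * ewa h p.1 + cum ewa h)) +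
      8 * eta * r ^+ 2 * eta * (p.2 ^+ 2 + gsq h) =
    - (eta * cum ewa h) + 8 * eta * r ^+ 2 * eta * gsq h +
      (- (eta * (p.2 * ewa h p.1)) + 8 * eta * r ^+ 2 * eta * p.2 ^+ 2) by ring.
  by rewrite [expR (_ + _ + (_ + _))]expRD [leRHS]mulrA.
have card_gt0 : 0 < #|E|%:R :> R by rewrite ltr0n; apply/card_gt0P; exists e.
have : ewa_weight h e <= \sum_e ewa_weight h e.
  rewrite (bigD1 e) //= lerDl.
  by apply: sumr_ge0 => e' _; exact: expR_ge0.
move=> /le_trans/(_ total_le).
move=> le_tot; have {}le_tot : expR (- (eta * cum (Q e) h)) <=
    expR (ln #|E|%:R + (- (eta * cum ewa h) + 8 * eta * r ^+ 2 * eta * gsq h)).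
  by rewrite expRD lnK ?posrE.
move: le_tot; rewrite ler_expR => le_exp.
have eta_ln : eta * (ln #|E|%:R / eta) = ln #|E|%:R.
  by rewrite mulrC divfK ?gt_eqF.
rewrite -(ler_pM2l eta_gt0) [leRHS]mulrDr eta_ln.
lra.
Qed.

End Ewa.
End OnlineLinear.

(** * Perceptron experts *)

Section Perceptron.
Context {R : realType} {d : nat}.
Implicit Types (h : seq (vec R d * R)) (w x : vec R d).

Lemma dotp_le1 x : norm2 x <= 1 -> dotp x x <= 1.
Proof.
rewrite /norm2 /dotp => x1; rewrite (eq_bigr (fun i => x i ^+ 2)) //.
have s0 : 0 <= \sum_i x i ^+ 2 by apply: sumr_ge0 => i _; exact: sqr_ge0.
by rewrite -(sqr_sqrtr s0) -[leRHS](expr1n R 2) ler_sqr ?nnegrE ?sqrtr_ge0.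
Qed.

Lemma dotpZl (c : R) w x : dotp (fun i => c * w i) x = c * dotp w x.
Proof. by rewrite /dotp mulr_sumr; apply: eq_bigr => i _; rewrite mulrA. Qed.

Lemma dotpC w x : dotp w x = dotp x w.
Proof. by apply: eq_bigr => i _; rewrite mulrC. Qed.

Lemma dotp_ge0 x : 0 <= dotp x x.
Proof. by apply: sumr_ge0 => i _; rewrite -expr2 sqr_ge0. Qed.

(** Serves both as the progress measure of a perceptron update and, with [v = 0], as the source of
    the Cauchy-Schwarz bound below. *)
Lemma dotp_update w v x (c : R) :
  \sum_i (w i - (v i + c * x i)) ^+ 2 =
  \sum_i (w i - v i) ^+ 2 - 2 * c * (dotp w x - dotp v x) + c ^+ 2 * dotp x x.
Proof.
rewrite /dotp -sumrB !mulr_sumr -sumrB -big_split /=.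
by apply: eq_bigr => i _; ring.
Qed.

Lemma dotp_norm_le1 w x : dotp w w <= 1 -> dotp x x <= 1 -> `|dotp w x| <= 1.
Proof.
move=> w1 x1.
have ge0 (c : R) : 0 <= dotp w w - 2 * c * dotp w x + c ^+ 2 * dotp x x.
  have := dotp_update w (fun=> 0) x c.
  have -> : \sum_i (w i - 0) ^+ 2 = dotp w w.
    by apply: eq_bigr => i _; rewrite subr0 expr2.
  have -> : dotp (fun=> 0) x = 0 by rewrite /dotp big1 // => i _; rewrite mul0r.
  by rewrite subr0 => <-; apply: sumr_ge0 => i _; exact: sqr_ge0.
have := ge0 1; have := ge0 (-1); rewrite ler_norml => ? ?.
by apply/andP; split; lra.
Qed.

Section Experts.
Variable N : nat.
Implicit Types (l : seq ('I_N.+1 * bool)) (eps : R).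

(* A pair (t, s) stands for an update [v := v + (-1)^s * eps * x_t] in round t;
   a round may have several updates, and t = N stands for no update. *)
Definition update_coef l (n : nat) : R :=
  \sum_(p <- l | p.1 == n :> nat) (-1) ^+ p.2.

Fixpoint perceptron eps l h : vec R d :=
  if h is p :: h' then
    fun i => perceptron eps l h' i + eps * update_coef l (size h') * p.1 i
  else fun=> 0.

Lemma perceptron_ext eps l l' h :
  (forall n, (n < size h)%N -> update_coef l n = update_coef l' n) ->
  perceptron eps l h = perceptron eps l' h.
Proof.
elim: h => //= p h IH coef_eq.
by rewrite IH ?coef_eq // => n n_lt; apply: coef_eq; exact: ltnW.
Qed.

Lemma rounds_size h n :
  (size h <= n)%N -> rounds (fun h' _ (_ : R) => (size h' < n)%N) h.
Proof. by elim: h => //= p h IH n_lt; split=> //; apply: IH; exact: ltnW. Qed.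

(* The updates of the current round are known to the expert when it predicts. *)
Definition perceptron_pred eps l h x : R :=
  dotp (perceptron eps l ((x, 0) :: h)) x.

Lemma perceptron_pred_ext eps l l' h x :
  (forall n, (n <= size h)%N -> update_coef l n = update_coef l' n) ->
  perceptron_pred eps l h x = perceptron_pred eps l' h x.
Proof. by move=> coef_eq; rewrite /perceptron_pred (perceptron_ext _ l l'). Qed.

(* Each update by an x of norm at most 1 on which the error exceeds eps lowers
   the squared distance to w by eps^2, so that after finitely many of them the
   error is at most eps. *)
Lemma perceptron_cover_round eps w h (p : vec R d * R) (m : nat) l :
  0 < eps -> dotp p.1 p.1 <= 1 -> (size h < N)%N ->
  1 < eps ^+ 2 * (size l + m)%:R ->
  all (fun q : 'I_N.+1 * bool => (q.1 <= size h)%N) l ->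
  \sum_i (w i - perceptron eps l (p :: h) i) ^+ 2 <=
    1 - eps ^+ 2 * (size l)%:R ->
  exists l' : seq ('I_N.+1 * bool),
    [/\ all (fun q : 'I_N.+1 * bool => (q.1 <= size h)%N) l',
        (forall n, (n < size h)%N -> update_coef l' n = update_coef l n),
        \sum_i (w i - perceptron eps l' (p :: h) i) ^+ 2 <=
          1 - eps ^+ 2 * (size l')%:R &
        `|dotp w p.1 - perceptron_pred eps l' h p.1| <= eps].
Proof.
move=> eps0 p1 sz; elim: m l => [|m IH] l fuel l_lt l_dist.
  (* [m] is fuel: once it is used up, [fuel] would make the squared distance negative. *)
  have : 0 <= 1 - eps ^+ 2 * (size l)%:R.
    by apply: le_trans l_dist; apply: sumr_ge0 => i _; exact: sqr_ge0.
  by rewrite addn0 in fuel; lra.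
have [good|bad] := leP `|dotp w p.1 - perceptron_pred eps l h p.1| eps.
  by exists l; split.
set D := dotp w p.1 - _ in bad; pose s := D < 0.
pose l1 := (inord (size h) : 'I_N.+1, s) :: l.
have l1E n : update_coef l1 n =
    (if size h == n then (-1) ^+ s else 0) + update_coef l n.
  rewrite /update_coef big_cons /= inordK; last exact: ltnW.
  by case: eqP => _; rewrite ?add0r.
have l1_old n : (n < size h)%N -> update_coef l1 n = update_coef l n.
  by move=> n_lt; rewrite l1E gtn_eqF ?add0r.
have [] := IH l1.
- by rewrite /= addSnnS.
- by rewrite /= inordK ?leqnn //; exact: ltnW.
- rewrite (_ : \sum_i _ = \sum_i (w i -
      (perceptron eps l (p :: h) i + eps * (-1) ^+ s * p.1 i)) ^+ 2); last first.
    apply: eq_bigr => i _ /=; rewrite (perceptron_ext _ l1 l) // l1E eqxx.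
    by congr (_ ^+ 2); ring.
  (* With [c = eps * (-1) ^+ s] the linear term lowers the squared distance by at least
     [2 * eps ^+ 2], and the quadratic term gives back at most [eps ^+ 2]. *)
  rewrite dotp_update.
  have -> : dotp w p.1 - dotp (perceptron eps l (p :: h)) p.1 = D by [].
  rewrite /= -natr1.
  have sq : (eps * (-1) ^+ s) ^+ 2 * dotp p.1 p.1 <= eps ^+ 2.
    by rewrite exprMn sqrr_sign mulr1 ler_piMr ?sqr_ge0.
  have signed : eps ^+ 2 <= eps * (-1) ^+ s * D.
    rewrite -mulrA expr2 ler_pM2l // /s.
    by move: bad; have [neg|pos] := ltP D 0;
      rewrite ?(ltr0_norm neg) ?(ger0_norm pos) ?mulN1r ?mul1r => /ltW.
  rewrite /= in l_dist; lra.
move=> l' [? l'_old ? ?]; exists l'; split=> // n n_lt.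
by rewrite l'_old // l1_old.
Qed.

(** The updates added for a new round carry its index, so the predictions made in earlier rounds
    stay as they were. *)
Lemma perceptron_cover_seq eps w h : 0 < eps -> dotp w w <= 1 ->
  rounds (fun _ x _ => dotp x x <= 1) h -> (size h <= N)%N ->
  exists l : seq ('I_N.+1 * bool),
    [/\ all (fun q : 'I_N.+1 * bool => (q.1 < size h)%N) l,
        \sum_i (w i - perceptron eps l h i) ^+ 2 <= 1 - eps ^+ 2 * (size l)%:R &
        rounds (fun h' x _ => `|dotp w x - perceptron_pred eps l h' x| <= eps) h].
Proof.
move=> eps0 w1; elim: h => [|p h IH] /=.
  move=> _ _; exists [::]; split=> //=.
  rewrite mulr0 subr0; apply: le_trans w1; rewrite le_eqVlt; apply/orP; left.
  by apply/eqP; apply: eq_bigr => i _; rewrite subr0 expr2.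
move=> [p1 h1] sz; have [l [l_lt l_dist l_ok]] := IH h1 (ltnW sz).
have coef0 : update_coef l (size h) = 0.
  rewrite /update_coef big_seq_cond big1 // => q /andP[ql /eqP qE].
  by have := allP l_lt _ ql; rewrite qE ltnn.
have e2 : 0 < eps ^+ 2 by exact: exprn_gt0.
have [|||l' [l'_lt l'_old l'_dist l'_ok]] :=
  @perceptron_cover_round eps w h p (Num.bound (eps ^+ 2)^-1) l eps0 p1 sz.
- rewrite mulrC -ltr_pdivrMr // div1r natrD ltr_wpDl // .
  by apply: archi_boundP; rewrite invr_ge0 ltW.
- by apply: sub_all l_lt => q; exact: ltnW.
- by under eq_bigr do rewrite /= coef0 mulr0 mul0r addr0.
exists l'; split=> //; split=> //.
have := roundsI _ _ _ l_ok (rounds_size _ _ (leqnn (size h))).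
apply: rounds_impl => h' x g [? sz']; rewrite (perceptron_pred_ext _ _ l) //.
by move=> n n_le; apply: l'_old; exact: leq_ltn_trans sz'.
Qed.

(** As the squared distance stays nonnegative, there are at most [m = eps^-2] updates. Padding with
    the dummy round [N], which [h] never reaches, gives all experts the same length. *)
Lemma perceptron_cover_tuple (m : nat) eps w h : 0 < eps ->
  eps ^+ 2 * m%:R = 1 -> dotp w w <= 1 ->
  rounds (fun _ x _ => dotp x x <= 1) h -> (size h <= N)%N ->
  exists e : m.-tuple ('I_N.+1 * bool),
    rounds (fun h' x _ => `|dotp w x - perceptron_pred eps e h' x| <= eps) h.
Proof.
move=> eps0 epsm w1 h1 sz.
have [l [_ l_dist l_ok]] := perceptron_cover_seq _ _ _ eps0 w1 h1 sz.
have le_lm : (size l <= m)%N.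
  have : 0 <= 1 - eps ^+ 2 * (size l)%:R.
    by apply: le_trans l_dist; apply: sumr_ge0 => i _; exact: sqr_ge0.
  rewrite subr_ge0 -[leRHS]epsm ler_pM2l ?exprn_gt0 //.
  by rewrite ler_nat.
have sz_e : size (l ++ nseq (m - size l) (ord_max : 'I_N.+1, true)) == m.
  by rewrite size_cat size_nseq subnKC.
exists (Tuple sz_e).
have := roundsI _ _ _ l_ok (rounds_size _ _ sz).
apply: rounds_impl => h' x g [le_eps sz']; rewrite -(perceptron_pred_ext _ l) //.
move=> n n_le; rewrite /update_coef big_cat /= big_nseq_cond /=.
by rewrite (gtn_eqF (leq_ltn_trans n_le sz')) addr0.
Qed.

(** Provides the zero expert from which the chain starts. *)
Lemma perceptron_pred_nseq (m : nat) eps h x : (size h < N)%N ->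
  perceptron_pred eps (nseq m (ord_max : 'I_N.+1, true)) h x = 0.
Proof.
move=> sz; rewrite (perceptron_pred_ext _ _ [::]); last first.
  move=> n n_le; rewrite /update_coef big_nil big_nseq_cond /=.
  by rewrite (gtn_eqF (leq_ltn_trans n_le sz)).
rewrite /perceptron_pred; move: (_ :: h) => h'.
rewrite (_ : perceptron _ _ _ = fun=> 0).
  by rewrite /dotp big1 // => i _; rewrite mul0r.
elim: h' => //= p h' ->; apply: funext => i.
by rewrite /update_coef big_nil mulr0 mul0r addr0.
Qed.

End Experts.
End Perceptron.

(** * Chaining *)

Section Chaining.
Context {R : realType} {d : nat}.
Implicit Types (h : seq (vec R d * R)) (w x : vec R d).

Definition clamp (r z : R) : R := Num.max (- r) (Num.min r z).

Lemma clamp_norm_le r z : 0 <= r -> `|clamp r z| <= r.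
Proof.
move=> r0; rewrite ler_norml /clamp le_max lexx /= ge_max ge_min lexx /=.
by rewrite andbT; lra.
Qed.

Lemma clamp_id r z : `|z| <= r -> clamp r z = z.
Proof.
by rewrite ler_norml => /andP[? ?]; rewrite /clamp min_r // max_r.
Qed.

Variables (phi : R -> R) (N L : nat) (theta : R).
Hypotheses (phi0 : phi 0 = 0) (phi_lip : forall y z, `|phi y - phi z| <= `|y - z|).
Hypothesis theta_gt0 : 0 < theta.

(** The length [4 ^ i] is the number of updates that accuracy [2^-1 ^+ i] allows. *)
Definition net i := (4 ^ i).-tuple ('I_N.+1 * bool).

Definition net_pred i (e : net i) h x : R :=
  perceptron_pred N (2^-1 ^+ i) e h x.

(** The clamp is inactive on two experts tracking the same [w], which differ by at most
    [3/2 * 2^-1 ^+ i]; it bounds the range of all other pairs, as exponential weights require. *)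
Definition link i (e : net i * net i.+1) h x : R :=
  clamp (2 * 2^-1 ^+ i) (phi (net_pred i.+1 e.2 h x) - phi (net_pred i e.1 h x)).

(** The learning rate grows like [4 ^+ i] to balance an entropy of order [4 ^+ i] against a squared
    range of order [4 ^- i], so that all scales have the same regret bound. *)
Definition chain h x : R :=
  \sum_(i < L) ewa (4 ^+ i * theta) (link i) h x.

Lemma halfX_gt0 i : 0 < 2^-1 ^+ i :> R.
Proof. by rewrite exprn_gt0 // invr_gt0. Qed.

Lemma halfX_sqr i : (2^-1 ^+ i) ^+ 2 * 4 ^+ i = 1 :> R.
Proof.
rewrite exprAC -exprMn (_ : 2^-1 ^+ 2 * 4 = 1) ?expr1n //.
by field.
Qed.

(** At scale 0 the zero expert is already accurate within 1; selecting it makes the telescoping sum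
    start at [phi 0 = 0]. *)
Lemma net_cover w h i : dotp w w <= 1 ->
  rounds (fun _ x _ => dotp x x <= 1) h -> (size h <= N)%N ->
  exists e : net i,
    rounds (fun h' x _ => `|dotp w x - net_pred i e h' x| <= 2^-1 ^+ i) h /\
    (i = 0%N -> rounds (fun h' x _ => net_pred i e h' x = 0) h).
Proof.
move=> w1 h1 sz; case: i => [|i]; last first.
  have [|e e_ok] := perceptron_cover_tuple N (4 ^ i.+1) (2^-1 ^+ i.+1) w h
    (halfX_gt0 _) _ w1 h1 sz; first by rewrite natrX halfX_sqr.
  by exists e.
have sz_e : size (nseq (4 ^ 0) (ord_max : 'I_N.+1, true)) == (4 ^ 0)%N.
  by rewrite size_nseq.
exists (Tuple sz_e).
have e0 : rounds (fun h' x _ => net_pred 0 (Tuple sz_e) h' x = 0) h.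
  apply: rounds_impl (rounds_size _ _ sz) => h' x _ sz'.
  by rewrite /net_pred perceptron_pred_nseq.
split=> //; have := roundsI _ _ _ h1 e0; apply: rounds_impl => h' x _ [x1 ->].
by rewrite subr0 expr0 dotp_norm_le1.
Qed.

Lemma link_regret i (e : net i * net i.+1) h :
  cum (ewa (4 ^+ i * theta) (link i)) h - cum (link i e) h <=
  5 * ln (2 * N.+1%:R) / theta + 32 * theta * gsq h.
Proof.
have four0 : 0 < 4 ^+ i :> R by rewrite exprn_gt0.
have e0 : 0 < 4 ^+ i * theta by rewrite mulr_gt0.
have link_le e' h' x : `|link i e' h' x| <= 2 * 2^-1 ^+ i.
  by apply: clamp_norm_le; rewrite mulr_ge0 // ltW ?halfX_gt0.
have := ewa_regret _ _ _ e0 link_le e h; move/le_trans; apply.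
have -> : 8 * (4 ^+ i * theta) * (2 * 2^-1 ^+ i) ^+ 2 = 32 * theta.
  transitivity (32 * theta * ((2^-1 ^+ i) ^+ 2 * 4 ^+ i)); first by ring.
  by rewrite halfX_sqr mulr1.
rewrite lerD2r le_eqVlt; apply/orP; left; apply/eqP.
(* There are [(2 * N.+1) ^ (5 * 4 ^ i)] pairs, and [4 ^ i] cancels against the learning rate. *)
rewrite card_prod !card_tuple card_prod card_ord card_bool -expnD natrX.
rewrite lnXn ?ltr0n ?muln_gt0 //.
rewrite natrM [_ * 2%:R]mulrC -[ln _ *+ _]mulr_natl natrD !natrX exprS.
by field; rewrite !gt_eqF.
Qed.

(** Along the experts that track [w] the links telescope to [phi] of the finest one, which is within
    [2^-1 ^+ L] of [phi (dotp w x)]; each link costs one exponential-weights regret. *)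
Lemma chain_regret w h : dotp w w <= 1 ->
  rounds (fun _ x _ => dotp x x <= 1) h -> (size h <= N)%N ->
  cum chain h - cum (fun _ x => phi (dotp w x)) h <=
  L%:R * (5 * ln (2 * N.+1%:R) / theta + 32 * theta * gsq h) +
  2^-1 ^+ L * gabs h.
Proof.
move=> w1 h1 sz.
pose e i : net i := projT1 (cid (net_cover w h i w1 h1 sz)).
have e_ok i : rounds (fun h' x _ => `|dotp w x - net_pred i (e i) h' x| <= 2^-1 ^+ i) h.
  by rewrite /e; case: cid => /= ? [].
have e_0 : rounds (fun h' x _ => net_pred 0 (e 0%N) h' x = 0) h.
  by rewrite /e; case: cid => /= ? [_]; exact.
pose step i h x := phi (net_pred i.+1 (e i.+1) h x) - phi (net_pred i (e i) h x).
have linkE i : cum (link i (e i, e i.+1)) h = cum (step i) h.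
  apply: eq_cum; have := roundsI _ _ _ (e_ok i) (e_ok i.+1).
  apply: rounds_impl => h' x _ [le1 le2]; rewrite /link clamp_id //=.
  apply: le_trans (phi_lip _ _) _.
  move: le1 le2; rewrite exprS !ler_norml => /andP[? ?] /andP[? ?].
  by have := halfX_gt0 i => ?; apply/andP; split; lra.
have close : cum (fun h x => \sum_(i < L) step i h x) h <=
    cum (fun _ x => phi (dotp w x)) h + 2^-1 ^+ L * gabs h.
  apply: cum_close; have := roundsI _ _ _ (e_ok L) e_0.
  apply: rounds_impl => h' x _ [leL eq0].
  rewrite -(big_mkord xpredT (fun i => step i h' x)) /step.
  rewrite (telescope_sumr (fun i => phi (net_pred i (e i) h' x))) // eq0 phi0.
  by rewrite subr0; apply: le_trans (phi_lip _ _) _; rewrite distrC.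
have : cum chain h - cum (fun h x => \sum_(i < L) step i h x) h <=
    L%:R * (5 * ln (2 * N.+1%:R) / theta + 32 * theta * gsq h).
  rewrite /chain !cum_sum -sumrB.
  apply: le_trans (ler_sum _ _) _.
    by move=> i _; rewrite -linkE; exact: link_regret.
  by rewrite sumr_const card_ord -[leLHS]mulr_natl.
lra.
Qed.

End Chaining.

(** * The conservative learner *)

Section ReluNetwork.
Context {R : realType}.

Lemma relu0 : relu (0 : R) = 0.
Proof. by rewrite /relu maxxx. Qed.

Lemma relu_lip (y z : R) : `|relu y - relu z| <= `|y - z|.
Proof.
have [yz|yz] := ger0P (y - z); rewrite /relu;
  have [?|?] := leP 0 y; have [?|?] := leP 0 z;
  rewrite ler_norml; apply/andP; split; lra.
Qed.

Lemma relu_scale (c z : R) : 0 <= c -> relu (c * z) = c * relu z.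
Proof. by move=> c0; rewrite /relu maxr_pMr // mulr0. Qed.

Lemma clip_cases (z : R) :
  [\/ z <= -1 /\ clip z = -1, -1 <= z <= 1 /\ clip z = z | 1 <= z /\ clip z = 1].
Proof.
rewrite /clip; have [z1|z1] := leP z (-1).
  by constructor 1; rewrite min_r ?max_l //; lra.
have [z2|z2] := leP z 1.
  by constructor 2; rewrite max_r ?(ltW z1) ?z2.
by constructor 3; rewrite max_r ?ltW //; lra.
Qed.

Lemma clip_lip (y z : R) : `|clip y - clip z| <= `|y - z|.
Proof.
by have [[? ->]|[/andP[? ?] ->]|[? ->]] := clip_cases y;
  have [[? ->]|[/andP[? ?] ->]|[? ->]] := clip_cases z;
  have [?|?] := ger0P (y - z); rewrite // ler_norml; apply/andP; split; lra.
Qed.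

Lemma clip_monotone (y z : R) :
  (clip y - clip z) ^+ 2 <= (clip y - clip z) * (y - z).
Proof.
by have [[? ->]|[/andP[? ?] ->]|[? ->]] := clip_cases y;
  have [[? ->]|[/andP[? ?] ->]|[? ->]] := clip_cases z; nra.
Qed.

Definition network {k d : nat} (a : 'I_k -> R) (w : 'I_k -> vec R d) (x : vec R d) : R :=
  \sum_(j < k) a j * relu (dotp (w j) x).

Variables (d k N L : nat) (alpha : R).
Implicit Types (h : seq (vec R d * R)) (w x : vec R d).

(** Chosen so that the second-order terms of the [L] scales add up to [gsq h / (8 * k)]. *)
Let theta : R := (256 * k%:R * L%:R)^-1.

Definition pm_chain (b : bool) h x : R :=
  chain (fun z => (-1) ^+ b * relu z) N L theta h x.

(** One chain per sign competes with all units at once, so [k] copies of the same pair stand for the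
    [k] units. *)
Definition network_pred h x : R := k%:R * (pm_chain false h x + pm_chain true h x).

Hypotheses (k_gt0 : (0 < k)%N) (L_gt0 : (0 < L)%N).

Let theta_gt0 : 0 < theta.
Proof. by rewrite invr_gt0 !mulr_gt0 // ltr0n. Qed.

Lemma pm_chain_regret b w h : dotp w w <= 1 ->
  rounds (fun _ x _ => dotp x x <= 1) h -> (size h <= N)%N ->
  cum (pm_chain b) h - cum (fun _ x => (-1) ^+ b * relu (dotp w x)) h <=
  1280 * k%:R * L%:R ^+ 2 * ln (2 * N.+1%:R) + gsq h / (8 * k%:R) +
  2^-1 ^+ L * gabs h.
Proof.
move=> w1 h1 sz.
have phi0 : (-1) ^+ b * relu 0 = 0 :> R by rewrite relu0 mulr0.
have phi_lip (y z : R) :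
    `|(-1) ^+ b * relu y - (-1) ^+ b * relu z| <= `|y - z|.
  by rewrite -mulrBr normrM normr_sign mul1r relu_lip.
have := @chain_regret R d _ N L theta phi0 phi_lip theta_gt0 w h w1 h1 sz.
move/le_trans; apply; rewrite lerD2r le_eqVlt; apply/orP; left; apply/eqP.
have k0 : k%:R != 0 :> R by rewrite pnatr_eq0 -lt0n.
have L0 : L%:R != 0 :> R by rewrite pnatr_eq0 -lt0n.
by rewrite /theta; field; rewrite k0.
Qed.

Lemma network_regret (a : 'I_k -> R) (w : 'I_k -> vec R d) h :
  (forall j, -1 <= a j <= 1) -> (forall j, dotp (w j) (w j) <= 1) ->
  rounds (fun _ x _ => dotp x x <= 1) h -> (size h <= N)%N ->
  cum network_pred h - cum (fun _ => network a w) h <=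
  2 * k%:R * (1280 * k%:R * L%:R ^+ 2 * ln (2 * N.+1%:R) + gsq h / (8 * k%:R) +
  2^-1 ^+ L * gabs h).
Proof.
move=> a1 w1 h1 sz; set reg := (X in _ <= _ * X).
pose part (b : bool) j : R := Num.max 0 ((-1) ^+ b * a j).
have part0 b j : 0 <= part b j by rewrite le_max lexx.
have part1 b j : part b j <= 1.
  have /andP[? ?] := a1 j.
  by rewrite /part ge_max ler01; case: b => /=; rewrite ?expr0 ?expr1; lra.
have partE j : a j = part false j - part true j.
  rewrite /part expr0 expr1 mul1r mulN1r.
  by have [?|?] := leP 0 (a j); have [?|?] := leP 0 (- a j); lra.
have partw b j : dotp (fun i => part b j * w j i) (fun i => part b j * w j i) <= 1.
  rewrite dotpZl dotpC dotpZl mulrA -expr2.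
  apply: mulr_ile1 => //; first exact: sqr_ge0.
    exact: dotp_ge0.
  by rewrite expr_le1.
have -> : cum (fun _ => network a w) h = \sum_(j < k)
    (cum (fun _ x => (-1) ^+ false * relu (dotp (fun i => part false j * w j i) x)) h +
     cum (fun _ x => (-1) ^+ true * relu (dotp (fun i => part true j * w j i) x)) h).
  rewrite -(eq_bigr _ (fun j _ => cumD _ _ h)) -cum_sum; congr (cum _ h).
  apply: funext => h'; apply: funext => x; apply: eq_bigr => j _.
  by rewrite !dotpZl !relu_scale // {1}partE expr0 expr1; ring.
rewrite /network_pred cumZ cumD.
have -> : k%:R * (cum (pm_chain false) h + cum (pm_chain true) h) =
  \sum_(j < k) (cum (pm_chain false) h + cum (pm_chain true) h).
  by rewrite sumr_const card_ord mulr_natl.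
rewrite -sumrB.
have -> : 2 * k%:R * reg = \sum_(j < k) (reg + reg).
  by rewrite sumr_const card_ord -[RHS]mulr_natl; ring.
apply: ler_sum => j _.
have := pm_chain_regret false _ h (partw false j) h1 sz.
have := pm_chain_regret true _ h (partw true j) h1 sz.
rewrite -/reg; lra.
Qed.

Definition conservative_update h (p : vec R d * R) : seq (vec R d * R) :=
  if alpha < `|clip (network_pred h p.1) - p.2|
  then (p.1, clip (network_pred h p.1) - p.2) :: h else h.

Definition conservative_state (s : seq (vec R d * R)) : seq (vec R d * R) :=
  foldl conservative_update [::] s.

Definition conservative : learner R d :=
  fun s x => clip (network_pred (conservative_state s) x).

Definition conservative_bound : R :=
  5120 * k%:R ^+ 2 * L%:R ^+ 2 * ln (2 * N.+1%:R).

Hypotheses (alpha_gt0 : 0 < alpha) (L_large : 2^-1 ^+ L <= alpha / (8 * k%:R)).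
Hypothesis N_large : conservative_bound < N%:R * alpha ^+ 2.

(** Self-bounding: since every recorded [|g|] exceeds [alpha], [gabs h <= gsq h / alpha]. The
    second-order and the discretisation terms are then at most [gsq h / 4] each and are absorbed on
    the left. *)
Lemma conservative_self_bound (a : 'I_k -> R) (w : 'I_k -> vec R d) h :
  (forall j, -1 <= a j <= 1) -> (forall j, dotp (w j) (w j) <= 1) ->
  rounds (fun _ x _ => dotp x x <= 1) h -> (size h <= N)%N ->
  rounds (fun h' x g => alpha < `|g| /\
    g = clip (network_pred h' x) - clip (network a w x)) h ->
  gsq h <= conservative_bound.
Proof.
move=> a1 w1 h1 sz hg.
have k0 : 0 < k%:R :> R by rewrite ltr0n.
have self : gsq h <= cum network_pred h - cum (fun _ => network a w) h.
  rewrite -cumB; elim: h hg {h1 sz} => /= [_|p h IH]; first by rewrite /gsq big_nil.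
  move=> [[_ gE] /IH{}IH]; rewrite gsq_cons lerD // {1 2}gE.
  exact: clip_monotone.
have gabs_le : alpha * gabs h <= gsq h.
  elim: h hg {h1 sz self} => /= [_|p h IH]; first by rewrite /gabs /gsq !big_nil mulr0.
  move=> [[p_gt _] /IH{}IH]; rewrite gsq_cons gabs_cons mulrDr lerD //.
  by rewrite -real_normK ?num_real // expr2 ler_wpM2r // ltW.
have := network_regret a w h a1 w1 h1 sz.
set B := 1280 * _ * _ * _.
have BE : conservative_bound = 4 * k%:R * B by rewrite /conservative_bound /B; ring.
have -> : 2 * k%:R * (B + gsq h / (8 * k%:R) + 2^-1 ^+ L * gabs h) =
    2 * k%:R * B + gsq h / 4 + 2 * k%:R * 2^-1 ^+ L * gabs h.
  by field; rewrite gt_eqF.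
have : 2 * k%:R * 2^-1 ^+ L * gabs h <= gsq h / 4.
  have -> : gsq h / 4 = 2 * k%:R * (gsq h / (8 * k%:R)) by field; rewrite gt_eqF.
  rewrite -mulrA ler_pM2l ?mulr_gt0 //.
  rewrite ler_pdivlMr ?mulr_gt0 //.
  apply: le_trans gabs_le; rewrite mulrAC ler_wpM2r //.
    by apply: sumr_ge0.
  by rewrite -ler_pdivlMr ?mulr_gt0.
lra.
Qed.

(** The size invariant needed by the regret bound survives a new update: each update costs more than
    [alpha ^+ 2], so [N_large] keeps their number below [N]. *)
Lemma conservative_state_bound (a : 'I_k -> R) (w : 'I_k -> vec R d) s :
  (forall j, -1 <= a j <= 1) -> (forall j, dotp (w j) (w j) <= 1) ->
  (forall p, List.In p s -> dotp p.1 p.1 <= 1 /\ p.2 = clip (network a w p.1)) ->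
  gsq (conservative_state s) <= conservative_bound.
Proof.
move=> a1 w1 s_ok.
suff [? ? ?] : [/\ rounds (fun _ x _ => dotp x x <= 1) (conservative_state s),
    (size (conservative_state s) <= N)%N &
    rounds (fun h' x g => alpha < `|g| /\
      g = clip (network_pred h' x) - clip (network a w x)) (conservative_state s)].
  exact: conservative_self_bound.
elim/last_ind: s s_ok => [//|s p IH] s_ok.
have [|s1 s_sz s_g] := IH.
  by move=> q q_in; apply: s_ok; rewrite -cats1; apply/List.in_app_iff; left.
have [p1 pE] : dotp p.1 p.1 <= 1 /\ p.2 = clip (network a w p.1).
  by apply: s_ok; rewrite -cats1; apply/List.in_app_iff; right; left.
rewrite /conservative_state foldl_rcons -/(conservative_state s).
set h := conservative_state s in s1 s_sz s_g *.
rewrite /conservative_update; case: ifP => // mistake.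
split=> /=; [by []| |by rewrite -pE].
have := conservative_self_bound a w h a1 w1 s1 s_sz s_g.
move=> /le_lt_trans/(_ N_large) gsq_lt.
rewrite -(ltr_nat R) -(ltr_pM2r (exprn_gt0 2 alpha_gt0)).
apply: le_lt_trans gsq_lt.
elim: (h) s_g => /= [_|q h' IHh]; first by rewrite /gsq big_nil mul0r.
move=> [[q_gt _] /IHh{}IHh].
rewrite gsq_cons -natr1 mulrDl mul1r addrC lerD //.
by rewrite -(real_normK (num_real q.2)) ler_sqr ?nnegrE // ltW.
Qed.

End ReluNetwork.

(** * Halving over parameter grids *)

Section Halving.
Context {R : realType} {d : nat} {E : finType}.
Variables (c : E -> vec R d -> R) (beta : R).
Implicit Types (s : seq (vec R d * R)) (x : vec R d).

Definition version_space s : {set E} :=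
  [set e | all (fun p => `|c e p.1 - p.2| <= beta / 2) s].

(** Predicts a value whose confirmation would keep more than half of the version space. If there is
    none, every outcome at least halves it, and the default 0 is harmless. *)
Definition halving : learner R d := fun s x =>
  xget 0 [set m | (#|version_space s| < 2 * #|version_space (rcons s (x, m))|)%N]%classic.

(* Two values each supported by more than half of the version space share a
   supporter, hence are beta-close. *)
Lemma halving_mistake s x y : beta < `|halving s x - y| ->
  (2 * #|version_space (rcons s (x, y))| <= #|version_space s|)%N.
Proof.
apply: contraTT; rewrite -ltnNge -leNgt => y_big.
rewrite /halving; case: xgetP => [m _ /= m_big|/(_ y) /=]; last by rewrite y_big.
have sub z : version_space (rcons s (x, z)) \subset version_space s.
  by apply/fintype.subsetP => e; rewrite !inE all_rcons => /andP[].
set Vy := version_space (rcons s (x, y)) in y_big *.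
set Vm := version_space (rcons s (x, m)) in m_big *.
have : (0 < #|Vy :&: Vm|)%N.
  have := cardsUI Vy Vm.
  have : (#|Vy :|: Vm| <= #|version_space s|)%N.
    by apply: subset_leq_card; rewrite finset.subUset !sub.
  move: y_big m_big; lia.
move=> /card_gt0P[e]; rewrite !inE !all_rcons /=.
rewrite !ler_norml => /andP[/andP[/andP[? ?] _] /andP[/andP[? ?] _]].
by apply/andP; split; lra.
Qed.

Lemma halving_mistakes (x : nat -> vec R d) (y : nat -> R) (e : E) (q T : nat) :
  (forall t, (t < T)%N -> `|c e (x t) - y t| <= beta / 2) ->
  (#|E| <= 2 ^ q)%N ->
  (\sum_(t < T) (beta < `|halving (history x y t) (x t) - y t|)%R <= q)%N.
Proof.
move=> e_ok E_le; set M := (X in (X <= _)%N).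
have e_in n : (n <= T)%N -> e \in version_space (history x y n).
  move=> n_le; rewrite inE /history all_map; apply/allP => t.
  by rewrite mem_iota => /= t_lt; apply: e_ok; exact: leq_trans n_le.
(* Each mistake pays for its factor 2 by halving the version space, which never loses [e]. *)
have : (2 ^ M * #|version_space (history x y T)| <= #|E|)%N.
  rewrite /M; elim: (T) => [|n IH]; first by rewrite big_ord0 mul1n max_card.
  rewrite big_ord_recr /=; apply: leq_trans IH.
  have -> : history x y n.+1 = rcons (history x y n) (x n, y n).
    by rewrite /history -[n.+1]addn1 iotaD map_cat /= cats1.
  have [mistake|_] := boolP (beta < _).
    by rewrite addn1 expnSr -mulnA leq_mul2l halving_mistake ?orbT.
  rewrite addn0 leq_mul2l; apply/orP; right; apply: subset_leq_card.
  by apply/fintype.subsetP => e'; rewrite !inE all_rcons => /andP[].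
move=> /leq_trans/(_ E_le) le_q.
rewrite -(leq_exp2l (m := 2)) //; apply: leq_trans le_q.
by rewrite leq_pmulr //; apply/card_gt0P; exists e; exact: e_in.
Qed.

End Halving.

(** * Grid approximation of networks *)

Section Grid.
Context {R : realType}.

Definition grid (n : nat) (i : 'I_(2 ^ n)) : R := -1 + 2 * i%:R / 2 ^+ n.

Lemma grid_bound n i : -1 <= grid n i <= 1.
Proof.
have n0 : 0 < 2 ^+ n :> R by exact: exprn_gt0.
have ige : 0 <= i%:R / 2 ^+ n :> R by rewrite divr_ge0 // ltW.
have ile : i%:R / 2 ^+ n <= 1 :> R.
  by rewrite ler_pdivrMr // mul1r -natrX ler_nat ltnW.
by rewrite /grid -mulrA; apply/andP; split; lra.
Qed.

Lemma grid_cover n (z : R) : -1 <= z <= 1 ->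
  exists i, `|z - grid n i| <= 2 * 2^-1 ^+ n.
Proof.
move=> /andP[z1 z2].
have n0 : 0 < 2 ^+ n :> R by exact: exprn_gt0.
pose u := (z + 1) / 2 * 2 ^+ n.
have u0 : 0 <= u by apply: mulr_ge0 (ltW n0); lra.
have uE : z = -1 + 2 * u / 2 ^+ n by rewrite /u; field; rewrite gt_eqF.
have /andP[tr1 tr2] := truncn_itv u0.
have closeP (m : nat) : `|u - m%:R| <= 1 ->
    `|z - (-1 + 2 * m%:R / 2 ^+ n)| <= 2 * 2^-1 ^+ n.
  rewrite {1}uE => um; rewrite (_ : _ - _ = (u - m%:R) * (2 * 2^-1 ^+ n)).
    have h0 : 0 <= 2 * 2^-1 ^+ n :> R by rewrite mulr_ge0 // ltW ?halfX_gt0.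
    by rewrite normrM (ger0_norm h0) ler_piMl.
  by rewrite exprVn; field; rewrite gt_eqF.
have [lt_n|ge_n] := ltnP (Num.truncn u) (2 ^ n).
  exists (Ordinal lt_n); apply: closeP => /=; rewrite -natr1 in tr2.
  by rewrite ler_norml; apply/andP; split; lra.
(* Only [z = 1] gets here: the grid omits this endpoint, and its last point is one step away. *)
have lt_n : ((2 ^ n).-1 < 2 ^ n)%N by rewrite prednK ?expn_gt0.
exists (Ordinal lt_n); apply: closeP => /=.
have u_le : u <= 2 ^+ n by apply: ler_piMl (ltW n0) _; lra.
have : (2 ^ n)%:R <= u by apply: le_trans tr1; rewrite ler_nat.
have : (2 ^ n)%:R = (2 ^ n).-1%:R + 1 :> R by rewrite natr1 prednK ?expn_gt0.
rewrite natrX => ? ?.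
by rewrite ler_norml; apply/andP; split; lra.
Qed.

Variables (k d n : nat).

Definition grid_params : finType :=
  ({ffun 'I_k -> 'I_(2 ^ n)} * {ffun 'I_k * 'I_d -> 'I_(2 ^ n)})%type.

Definition grid_network (e : grid_params) (x : vec R d) : R :=
  clip (network (fun j => grid n (e.1 j)) (fun j i => grid n (e.2 (j, i))) x).

Lemma card_grid_params : #|grid_params| = (2 ^ (n * (k + k * d)))%N.
Proof.
by rewrite card_prod !card_ffun !card_prod !card_ord -expnD -expnM.
Qed.

Lemma coord_norm_le1 (x : vec R d) i : dotp x x <= 1 -> `|x i| <= 1.
Proof.
move=> x1.
rewrite -(expr_le1 (n := 2)) // real_normK ?num_real //; apply: le_trans x1.
rewrite /dotp (bigD1 i) //= -expr2 lerDl.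
by apply: sumr_ge0 => j _; rewrite -expr2 sqr_ge0.
Qed.

Lemma grid_network_cover (a : 'I_k -> R) (w : 'I_k -> vec R d) :
  (forall j, -1 <= a j <= 1) -> (forall j, dotp (w j) (w j) <= 1) ->
  exists e : grid_params, forall x, dotp x x <= 1 ->
    `|grid_network e x - clip (network a w x)| <=
    k%:R * (1 + d%:R) * (2 * 2^-1 ^+ n).
Proof.
move=> a1 w1; set dl := 2 * _.
have dl0 : 0 <= dl by rewrite mulr_ge0 // ltW ?halfX_gt0.
have wc j i : -1 <= w j i <= 1 by rewrite -ler_norml coord_norm_le1.
pose ea j := projT1 (cid (grid_cover n (a j) (a1 j))).
have eaP j : `|a j - grid n (ea j)| <= dl by rewrite /ea; case: cid.
pose ew j i := projT1 (cid (grid_cover n (w j i) (wc j i))).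
have ewP j i : `|w j i - grid n (ew j i)| <= dl by rewrite /ew; case: cid.
exists ([ffun j => ea j], [ffun p => ew p.1 p.2]) => x x1.
apply: le_trans (clip_lip _ _) _; rewrite /network -sumrB.
apply: le_trans (ler_norm_sum _ _ _) _.
rewrite -mulrA mulr_natl -[X in _ <= _ *+ X](card_ord k) -sumr_const.
apply: ler_sum => j _ /=; rewrite ffunE.
set v := fun i => _.
(* Changing the inner weights and the outer coefficient one after the other costs [d * dl] and
   [dl]. *)
have -> : grid n (ea j) * relu (dotp v x) - a j * relu (dotp (w j) x) =
  grid n (ea j) * (relu (dotp v x) - relu (dotp (w j) x)) -
  (a j - grid n (ea j)) * relu (dotp (w j) x) by ring.
apply: le_trans (ler_normB _ _) _; rewrite [leRHS]mulrDl mul1r addrC !normrM.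
have relu1 : `|relu (dotp (w j) x)| <= 1.
  rewrite -[relu _]subr0 -relu0; apply: le_trans (relu_lip _ _) _.
  by rewrite subr0 dotp_norm_le1.
apply: lerD; first by rewrite -[leRHS]mulr1 ler_pM.
have : `|grid n (ea j)| <= 1 by rewrite ler_norml grid_bound.
have : `|relu (dotp v x) - relu (dotp (w j) x)| <= d%:R * dl.
  apply: le_trans (relu_lip _ _) _; rewrite /dotp -sumrB.
  apply: le_trans (ler_norm_sum _ _ _) _.
  rewrite mulr_natl -[X in _ <= _ *+ X](card_ord d) -sumr_const.
  apply: ler_sum => i _; rewrite -mulrBl normrM -[leRHS]mulr1.
  by rewrite ler_pM ?coord_norm_le1 // /v ffunE distrC /=.
by move=> ? ?; rewrite -[leRHS]mul1r ler_pM.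
Qed.

End Grid.

(** * Combination of scales *)

Section Combination.
Context {R : realType} {d : nat}.
Variables (b : nat -> learner R d) (beta : nat -> R).
Hypothesis beta_ge0 : forall i, 0 <= beta i.
Implicit Types (s : seq (vec R d * R)) (x : vec R d).

Fixpoint combine_from (n i : nat) s x : R :=
  if n is n'.+1 then b i s x + clamp (beta i) (combine_from n' i.+1 s x - b i s x)
  else b i s x.

(** The depth grows with the round, which makes the leftover errors of the finest scales summable
    over time. *)
Definition combine : learner R d := fun s x => combine_from (size s).+1 0 s x.

Lemma clamp_dist_le (r z u : R) : `|z| <= r -> `|clamp r u - z| <= `|u - z|.
Proof.
rewrite ler_norml /clamp => /andP[? ?].
have [ur|ur] := leP r u.
  rewrite max_r; last lra.
  by rewrite !ger0_norm; lra.
have [ur'|ur'] := leP u (- r).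
  by rewrite !ler0_norm; lra.
by [].
Qed.

(** Both the projection and [y] lie in the interval of radius [r] around [c], and projecting onto an
    interval that contains [y] never moves away from [y]. *)
Lemma clamp_step (c y r u : R) : 0 <= r -> `|c - y| <= r ->
  `|c + clamp r (u - c) - y| <= Num.min (2 * r) `|u - y|.
Proof.
move=> r0 cy; rewrite le_min; apply/andP; split.
  have := clamp_norm_le r (u - c) r0; move: cy; rewrite !ler_norml.
  by move=> /andP[? ?] /andP[? ?]; apply/andP; split; lra.
have := clamp_dist_le r (y - c) (u - c); rewrite distrC cy => /(_ isT).
by rewrite (_ : u - c - (y - c) = u - y) 1?(_ : clamp r (u - c) - (y - c) =
  c + clamp r (u - c) - y); try ring.
Qed.

(** The minimum with [2 * beta i] reflects the clamp at a correct scale [i]. The first wrong finer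
    scale is charged the width of the scale just before it; if none is wrong, the finest width
    remains. *)
Lemma combine_from_error n i s x (y : R) :
  (Num.min (2 * beta i) `|combine_from n i.+1 s x - y|) ^+ 2 <=
  \sum_(j < n.+1) (2 * beta (i + j)) ^+ 2 *
     (beta (i + j).+1 < `|b (i + j).+1 s x - y|)%R%:R
  + (2 * beta (i + n).+1) ^+ 2.
Proof.
have b2 m : 0 <= 2 * beta m by rewrite mulr_ge0.
have min0 m (z : R) : 0 <= Num.min (2 * beta m) `|z| by rewrite le_min b2 /=.
elim: n i => [|n IH] i.
  rewrite big_ord1 /= addn0; have [mistake|ok] := ltP.
    rewrite mulr1 -[leLHS]addr0 lerD ?sqr_ge0 // ler_sqr ?nnegrE ?min0 ?b2 //.
    by rewrite ge_min lexx.
  rewrite mulr0n mulr0 add0r ler_sqr ?nnegrE ?min0 ?b2 //.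
  rewrite ge_min; apply/orP; right; apply: le_trans ok _.
  by have := beta_ge0 i.+1; lra.
rewrite big_ord_recl addn0.
have tail0 : 0 <= \sum_(j < n.+1) (2 * beta (i + lift ord0 j)) ^+ 2 *
    (beta (i + lift ord0 j).+1 < `|b (i + lift ord0 j).+1 s x - y|)%R%:R.
  by apply: sumr_ge0 => j _; rewrite mulr_ge0 ?sqr_ge0.
have [mistake|ok] := ltP (beta i.+1) _.
  rewrite mulr1 -[leRHS]addrA -[leLHS]addr0; apply: lerD; last first.
    by rewrite addr_ge0 ?sqr_ge0.
  by rewrite ler_sqr ?nnegrE ?min0 ?b2 //= ge_min lexx.
rewrite mulr0n mulr0 add0r.
rewrite (eq_bigr (fun j : 'I_n.+1 => (2 * beta (i.+1 + j)) ^+ 2 *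
     (beta (i.+1 + j).+1 < `|b (i.+1 + j).+1 s x - y|)%R%:R)); last first.
  by move=> j _; rewrite lift0 addSnnS.
rewrite -addSnnS; apply: le_trans (IH i.+1).
rewrite ler_sqr ?nnegrE ?min0 ?b2 //= ge_min; apply/orP; right.
exact: clamp_step.
Qed.

Lemma combine_error s x (y : R) :
  (combine s x - y) ^+ 2 <=
  4 * (b 0 s x - y) ^+ 2 * (beta 0 < `|b 0 s x - y|)%R%:R +
  \sum_(j < (size s).+1) (2 * beta j) ^+ 2 * (beta j.+1 < `|b j.+1 s x - y|)%R%:R
  + (2 * beta (size s).+1) ^+ 2.
Proof.
rewrite /combine /=; have tail0 := combine_from_error (size s) 0 s x y.
have [mistake|ok] := ltP (beta 0) _; last first.
  rewrite mulr0n mulr0 add0r; apply: le_trans tail0.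
  rewrite -real_normK ?num_real // ler_sqr ?nnegrE //.
    exact: clamp_step.
  by rewrite le_min mulr_ge0 /=.
rewrite mulr1 -[leRHS]addrA -[leLHS]addr0 lerD //; last first.
  by apply: le_trans tail0; exact: sqr_ge0.
rewrite (_ : 4 * _ = (2 * (b 0 s x - y)) ^+ 2); last by ring.
rewrite -real_normK ?num_real // -[leRHS]real_normK ?num_real //.
rewrite ler_sqr ?nnegrE // normrM (ger0_norm (x := 2)) //.
(* At a mistake of scale 0 the correction, at most [beta 0], is smaller than the error itself, so
   the error at most doubles. *)
apply: le_trans (_ : `|b 0 s x - y| + beta 0 <= _); last by lra.
rewrite addrAC; apply: le_trans (ler_normD _ _) _.
by rewrite lerD2l clamp_norm_le.
Qed.

Lemma combine_loss (x : nat -> vec R d) (y : nat -> R) (q : nat -> nat) (T : nat) :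
  (forall i, (\sum_(t < T)
     (beta i.+1 < `|b i.+1 (history x y t) (x t) - y t|)%R <= q i)%N) ->
  cum_sq_loss combine x y T <=
  4 * \sum_(t < T) (b 0 (history x y t) (x t) - y t) ^+ 2 *
        (beta 0 < `|b 0 (history x y t) (x t) - y t|)%R%:R +
  \sum_(j < T) (2 * beta j) ^+ 2 * (q j)%:R +
  \sum_(t < T) (2 * beta t.+1) ^+ 2.
Proof.
move=> q_ok; rewrite /cum_sq_loss.
apply: le_trans (ler_sum _ (fun t _ => combine_error _ _ _)) _.
rewrite !big_split /= lerD //; last first.
  by apply: ler_sum => t _; rewrite /history size_map size_iota.
rewrite lerD //; first by rewrite mulr_sumr ler_sum // => t _; rewrite mulrA.
pose mist (t j : nat) : R := (2 * beta j) ^+ 2 *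
  (beta j.+1 < `|b j.+1 (history x y t) (x t) - y t|)%R%:R.
have mist0 t j : 0 <= mist t j by rewrite mulr_ge0 ?sqr_ge0.
apply: le_trans (_ : \sum_(t < T) \sum_(j < T) mist t j <= _).
  apply: ler_sum => t _; rewrite /history size_map size_iota -/(history x y t).
  rewrite -(big_mkord xpredT (mist t)) -(big_mkord xpredT (mist t)).
  rewrite (big_cat_nat _ (n := t.+1) (p := T)) //=.
  by rewrite lerDl sumr_ge0.
rewrite exchange_big /=; apply: ler_sum => j _.
by rewrite /mist -mulr_sumr ler_wpM2l ?sqr_ge0 // -natr_sum ler_nat.
Qed.

End Combination.

(** * From learners to the online dimension *)

Section LearnerToDimension.
Context {R : realType} {d : nat}.

Lemma branch_rec (f : seq bool -> bool) :
  exists b : nat -> bool, forall t, b t = f (Defs.prefix b t).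
Proof.
pose path := fix path n := if n is n'.+1 then rcons (path n') (f (path n')) else [::].
exists (fun t => f (path t)) => t; congr f.
elim: t => [//|t IH].
by rewrite /Defs.prefix /mkseq -[t.+1]addn1 iotaD map_cat cats1 /= addn1 /= {1}IH.
Qed.

(* Along the branch that always follows the edge farther from the learner's
   prediction, every round costs the learner at least the gap. *)
Lemma Donl_le_learner (H : set (vec R d -> R)) (A : learner R d) (B : R) :
  (forall x y T, realizable_seq H x y T -> cum_sq_loss A x y T <= B) ->
  (Donl H <= B%:E)%E.
Proof.
move=> A_ok; apply: ge_ereal_sup => v [D [x [s [[x_ok H_ok] ->]]]].
(* The past is read off the node, so the adversary's choice [far] depends on the node alone. *)
pose hist u := [seq (x (take i u), s (take i u) (nth false u i)) | i <- iota 0 (size u)].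
pose far u := `|A (hist u) (x u) - s u false| <= `|A (hist u) (x u) - s u true|.
have [b bE] := branch_rec far.
pose X t := x (Defs.prefix b t); pose Y t := s (Defs.prefix b t) (b t).
have histE t : hist (Defs.prefix b t) = history X Y t.
  rewrite /hist /history size_mkseq; apply/eq_in_map => i.
  rewrite mem_iota /= => i_lt; rewrite nth_mkseq //.
  by rewrite /Defs.prefix /mkseq -map_take take_iota (minn_idPl (ltnW i_lt)).
have gap_le t : gap s (Defs.prefix b t) <= (A (history X Y t) (X t) - Y t) ^+ 2.
  rewrite /gap /lcap -histE /X /Y; move: (bE t); rewrite /far.
  set p := A _ _; set s0 := s _ false; set s1 := s _ true => bt.
  apply: le_trans (_ : (s0 - s1) ^+ 2 / 4 <= _); first by rewrite ge_min lexx orbT.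
  (* Parallelogram identity: [(p - s0)^2 + (p - s1)^2] is at least [(s0 - s1)^2 / 2], and the larger
     square is at least half of the sum. *)
  have := sqr_ge0 (p + p - s0 - s1); move: bt.
  rewrite -ler_sqr ?nnegrE // !real_normK ?num_real //.
  by have [le_p ->|lt_p ->] := leP; rewrite -/s0 -/s1; nra.
have sum_le n : le_depth D n -> \sum_(t < n) gap s (Defs.prefix b t) <= B.
  move=> n_le; apply: le_trans (A_ok X Y n _).
    by apply: ler_sum => t _; exact: gap_le.
  split; last first.
    by have [h Hh h_ok] := H_ok b n n_le; exists h => // t /h_ok.
  move=> t t_lt; apply: x_ok; rewrite size_mkseq.
  by move: n_le; case: (D) => //= m; exact: leq_trans.
apply: le_trans (_ : branch_gain D s b <= _)%E.
  by apply: ereal_inf_lbound; exists b.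
rewrite /branch_gain; case: D {H_ok x_ok} sum_le => [m|] sum_le.
  by rewrite lee_fin; apply: sum_le; rewrite /= leqnn.
have gap_ge0 t : (0 <= (gap s (Defs.prefix b t))%:E)%E.
  by rewrite lee_fin /gap /lcap le_min ler01 divr_ge0 // sqr_ge0.
apply: lime_le; first by apply: is_cvg_nneseries => ? _ _; exact: gap_ge0.
by near=> n; rewrite big_mkord sumEFin lee_fin; exact: sum_le.
Unshelve. all: by end_near. Qed.

End LearnerToDimension.

(** * Choice of the scales *)

Section Rates.
Context {R : realType}.

Lemma ln2_bounds : 1 / 2 <= ln (2 : R) <= 1.
Proof.
have e1 := expR_ge1Dx (1 : R); have e2 := expR_ge1Dx (- (1 / 2) : R).
apply/andP; split.
  rewrite -ler_expR lnK ?posrE //.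
  have := expRxMexpNx_1 (1 / 2 : R); have := expR_gt0 (1 / 2 : R).
  by move: e2; set u := expR _; set v := expR _; nra.
by rewrite -ler_expR lnK ?posrE //; lra.
Qed.

(** Rounding [d * k] up to a power of two lets all scales be powers of two; the factor [expR 1]
    absorbs the rounding. *)
Lemma scale_exists (d k : nat) : (0 < d)%N -> (0 < k)%N ->
  exists l : nat, [/\ (0 < l)%N, (d%:R * k%:R : R) <= 2 ^+ l &
    (l%:R : R) <= 2 * ln (expR 1 * d%:R * k%:R)].
Proof.
move=> d_gt0 k_gt0; exists (trunc_log 2 (d * k)).+1.
have dk0 : (0 < d * k)%N by rewrite muln_gt0 d_gt0.
have dk0' : 0 < (d * k)%:R :> R by rewrite ltr0n.
split=> //; first by rewrite -natrM -natrX ler_nat ltnW // trunc_log_ltn.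
rewrite -mulrA -natrM lnM ?posrE ?expR_gt0 // expRK -natr1.
have : (2 : R) ^+ (trunc_log 2 (d * k)) <= (d * k)%:R.
  by rewrite -natrX ler_nat trunc_logP.
rewrite -ler_ln ?posrE ?exprn_gt0 // lnXn // -[ln 2 *+ _]mulr_natr.
have /andP[+ _] := ln2_bounds.
have : 0 <= (trunc_log 2 (d * k))%:R :> R by [].
by nra.
Qed.

Variables (k l : nat).
Hypotheses (l_gt0 : (0 < l)%N) (k_le : (k%:R : R) <= 2 ^+ l).
Local Notation K := ((2 : R) ^+ l).
(** With [alpha = 1 / K], the exponent 30 gives [N * alpha ^+ 2 = K ^+ 28], and [L = 2 * l + 3]
    gives [2^-1 ^+ L = alpha / (8 * K)]. *)
Local Notation N := (2 ^ (30 * l))%N.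
Local Notation L := (2 * l + 3)%N.

Lemma exp2_ge (m : nat) : (m%:R : R) <= 2 ^+ m.
Proof. by rewrite -natrX ler_nat ltnW // ltn_expl. Qed.

Lemma ln_N_le : ln (2 * N.+1%:R) <= 32 * l%:R :> R.
Proof.
have /andP[_ ln2] := ln2_bounds.
apply: le_trans (_ : ln (2 ^+ (32 * l)) <= _); last first.
  by rewrite lnXn // -natrM -[ln 2 *+ _]mulr_natr ler_piMl.
rewrite ler_ln ?posrE ?exprn_gt0 ?mulr_gt0 // -natrX -natrM ler_nat.
have -> : (32 * l = 30 * l + 2 * l)%N by lia.
rewrite expnD; have : (2 ^ 2 <= 2 ^ (2 * l))%N by rewrite leq_exp2l //; lia.
have : (0 < N)%N by rewrite expn_gt0.
by move: N (2 ^ (2 * l))%N => n m; nia.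
Qed.

Lemma conservative_bound_le :
  conservative_bound k N L <= 125 * 2 ^+ 15 * k%:R ^+ 2 * l%:R ^+ 3 :> R.
Proof.
have L_le : (L%:R : R) <= 5 * l%:R by rewrite -natrM ler_nat; lia.
have ln0 : 0 <= ln (2 * N.+1%:R) :> R by rewrite ln_ge0 // -natrM ler1n.
have := ln_N_le; rewrite /conservative_bound; move: (ln _) ln0 => u u0 u_le.
have -> : 125 * 2 ^+ 15 * k%:R ^+ 2 * l%:R ^+ 3 =
  5120 * k%:R ^+ 2 * (5 * l%:R) ^+ 2 * (32 * l%:R) :> R by ring.
have k0 : 0 <= 5120 * k%:R ^+ 2 :> R by apply: mulr_ge0; [exact: ler0n | exact: sqr_ge0].
move: (5120 * k%:R ^+ 2) k0 => v v0.
apply: ler_pM => //; first by rewrite mulr_ge0 ?sqr_ge0.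
by apply: ler_wpM2l => //; rewrite ler_sqr ?nnegrE ?mulr_ge0.
Qed.

Lemma conservative_bound_lt :
  conservative_bound k N L < N%:R * (2^-1 ^+ l) ^+ 2 :> R.
Proof.
apply: le_lt_trans conservative_bound_le _.
have lK := exp2_ge l.
have K2 : 2 <= K by rewrite -[leLHS]expr1 ler_eXn2l // ltr1n.
have -> : N%:R * (2^-1 ^+ l) ^+ 2 = K ^+ 23 * (K ^+ 2 * K ^+ 3) :> R.
  have -> : N%:R = K ^+ 23 * (K ^+ 2 * K ^+ 3) * K ^+ 2 :> R.
    by rewrite natrX [(30 * l)%N]mulnC exprM; move: (2 ^+ l) => M; ring.
  have K0 : K != 0 by rewrite expf_neq0 // pnatr_eq0.
  by rewrite exprVn; move: K K0 => M M0; field.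
move: K lK K2 k_le => M lM M2 kM.
have M0 : 0 < M by lra.
(* Of the 28 powers of [K], five dominate [k ^+ 2 * l ^+ 3]; the other 23 dominate the constant
   because [125 < 2 ^+ 8]. *)
have c_lt : 125 * 2 ^+ 15 < M ^+ 23 :> R.
  apply: lt_le_trans (_ : 2 ^+ 23 <= _); last first.
    by rewrite lerXn2r ?nnegrE // ltW.
  by rewrite [ltRHS](exprD _ 8 15) ltr_pM2r ?exprn_gt0 //; lra.
apply: le_lt_trans (_ : 125 * 2 ^+ 15 * (M ^+ 2 * M ^+ 3) < _).
  rewrite -mulrA; apply: ler_wpM2l; first by rewrite mulr_ge0 ?exprn_ge0.
  apply: ler_pM; rewrite ?exprn_ge0 //.
    by rewrite lerXn2r ?nnegrE // ltW.
  by rewrite lerXn2r ?nnegrE // ltW.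
by rewrite ltr_pM2r // mulr_gt0 ?exprn_gt0.
Qed.

End Rates.

(** * The multiscale learner and its loss *)

Section MultiscaleLearner.
Context {R : realType}.
Variables d k l : nat.
Hypotheses (d_gt0 : (0 < d)%N) (k_gt0 : (0 < k)%N) (l_gt0 : (0 < l)%N).
Hypothesis dk_le : (d%:R * k%:R : R) <= 2 ^+ l.
Local Notation K := ((2 : R) ^+ l).

Let k_le : (k%:R : R) <= K.
Proof. by apply: le_trans dk_le; rewrite ler_peMl ?ler1n. Qed.

Let K_gt0 : 0 < K. Proof. exact: exprn_gt0. Qed.

Let K_ge1 : 1 <= K.
Proof. by rewrite exprn_ege1 // ler1n. Qed.

Definition scale (i : nat) : R := 2^-1 ^+ (l + i).

(** At resolution [n = 2 * l + j + 4] the grid error [k * (1 + d) * 2 * 2^-1 ^+ n] is at most half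
    of [scale j.+1]. *)
Definition scale_learner (i : nat) : learner R d :=
  if i is j.+1 then
    halving (grid_network k d (2 * l + j + 4)) (scale j.+1)
  else conservative d k (2 ^ (30 * l)) (2 * l + 3) (2^-1 ^+ l).

Definition multiscale : learner R d := combine scale_learner scale.

Lemma scaleE i : scale i = K^-1 * 2^-1 ^+ i.
Proof. by rewrite /scale exprD exprVn. Qed.

Lemma sum_halfX (T : nat) : \sum_(t < T) 2^-1 ^+ t <= 2 :> R.
Proof.
suff -> : \sum_(t < T) 2^-1 ^+ t = 2 - 2 * 2^-1 ^+ T :> R.
  by have := @halfX_gt0 R T; lra.
elim: T => [|T IH]; first by rewrite big_ord0 expr0; lra.
by rewrite big_ord_recr /= IH exprS; field.
Qed.

Lemma half_scale_cover (j : nat) (a : 'I_k -> R) (w : 'I_k -> vec R d) :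
  (forall j, -1 <= a j <= 1) -> (forall j, dotp (w j) (w j) <= 1) ->
  exists e : grid_params k d (2 * l + j + 4), forall x, dotp x x <= 1 ->
    `|grid_network k d _ e x - clip (network a w x)| <= scale j.+1 / 2.
Proof.
move=> a1 w1.
have [e e_ok] := grid_network_cover k d (2 * l + j + 4) a w a1 w1.
exists e => x /e_ok/le_trans; apply.
have -> : scale j.+1 / 2 = 2 * K * (2 * 2^-1 ^+ (2 * l + j + 4)).
  rewrite scaleE (mulnC 2 l) !exprD exprM exprS !exprVn; field.
  by rewrite !gt_eqF // exprn_gt0.
apply: ler_wpM2r; first by rewrite mulr_ge0 // ltW ?halfX_gt0.
rewrite mulrDr mulr1 (mulr_natl K 2) mulr2n; apply: lerD => //.
by rewrite mulrC.
Qed.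

(** Binary logarithm of the number of grid parameters. *)
Definition mistake_budget (j : nat) : nat := ((2 * l + j + 4) * (k + k * d))%N.

(** The budget is at most [16 * K ^+ 2 * 2 ^+ j], while the squared width is
    [4 * K ^- 2 * 4 ^- j]. *)
Lemma budget_le (j : nat) :
  (2 * scale j) ^+ 2 * (mistake_budget j)%:R <= 64 * 2^-1 ^+ j.
Proof.
have J1 : 1 <= 2 ^+ j :> R by rewrite exprn_ege1 // ler1n.
have J0 : 0 < 2 ^+ j :> R by exact: exprn_gt0.
have le1 : (2 * l + j + 4)%:R <= 8 * K * 2 ^+ j :> R.
  have := @exp2_ge R l; have := @exp2_ge R j.
  rewrite (natrD _ (2 * l + j)) (natrD _ (2 * l)) natrM.
  by move: K_ge1 J1; move: K (2 ^+ j) => M J; nra.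
have le2 : (k + k * d)%:R <= 2 * K :> R.
  rewrite (natrD _ k) natrM (mulr_natl K 2) mulr2n; apply: lerD => //.
  by rewrite mulrC.
apply: le_trans (_ : (2 * scale j) ^+ 2 * (8 * K * 2 ^+ j * (2 * K)) <= _).
  by apply: ler_wpM2l; [exact: sqr_ge0 | rewrite /mistake_budget natrM; exact: ler_pM].
rewrite scaleE exprVn le_eqVlt; apply/orP; left; apply/eqP; field.
by rewrite !gt_eqF.
Qed.

Lemma scale_sqr_le (t : nat) : (2 * scale t.+1) ^+ 2 <= 2^-1 ^+ t.
Proof.
rewrite scaleE [_ ^+ t.+1]exprS; have h0 := @halfX_gt0 R t.
have h1 : 2^-1 ^+ t <= 1 :> R.
  by rewrite exprn_ile1 ?invr_ge0 // invf_le1 // ler1n.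
have K1 : K^-1 <= 1 by rewrite invf_le1.
have Kp : 0 < K^-1 by rewrite invr_gt0.
move: (K^-1) (2^-1 ^+ t) K1 Kp h0 h1 => c u c1 c0 u0 u1.
rewrite (_ : 2 * (c * _) = c * u); last by field.
have cu : c * u <= u by rewrite ler_piMl // ltW.
have cu0 : 0 <= c * u by rewrite mulr_ge0 // ltW.
have cu1 := le_trans cu u1.
by rewrite expr2; apply: le_trans cu; apply: ler_piMr.
Qed.

Lemma conservative_cum (x : nat -> vec R d) (y : nat -> R) (N L : nat) (alpha : R)
    (T : nat) :
  \sum_(t < T) (conservative d k N L alpha (history x y t) (x t) - y t) ^+ 2 *
     (alpha < `|conservative d k N L alpha (history x y t) (x t) - y t|)%R%:R =
  gsq (conservative_state d k N L alpha (history x y T)).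
Proof.
elim: T => [|T IH]; first by rewrite big_ord0 /gsq big_nil.
rewrite big_ord_recr /= IH.
have -> : history x y T.+1 = rcons (history x y T) (x T, y T).
  by rewrite /history -[T.+1]addn1 iotaD map_cat /= cats1.
rewrite /conservative_state foldl_rcons -/(conservative_state d k N L alpha _).
rewrite /conservative_update /conservative /=; case: ifP => _.
  by rewrite gsq_cons mulr1 addrC.
by rewrite mulr0 addr0.
Qed.

(** The three contributions are learner 0 with its errors doubled, the halving mistakes summed
    geometrically over the scales, and the leftover widths summed over the rounds. *)
Lemma multiscale_loss (x : nat -> vec R d) (y : nat -> R) (T : nat) :
  realizable_seq (@Hkd R k d) x y T ->
  cum_sq_loss multiscale x y T <=
  4 * (125 * 2 ^+ 15 * k%:R ^+ 2 * l%:R ^+ 3) + (64 * 2 + 2).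
Proof.
move=> [x_ok [h [a [w [a1 [w1' hE]]]] y_ok]].
have w1 j : dotp (w j) (w j) <= 1 by exact: dotp_le1.
have yE t : (t < T)%N -> y t = clip (network a w (x t)) by move=> /y_ok ->; rewrite hE.
have x1 t : (t < T)%N -> dotp (x t) (x t) <= 1 by move=> /x_ok[_ /dotp_le1].
have scale_ge0 i : 0 <= scale i by rewrite ltW ?halfX_gt0.
have budget_ok i : (\sum_(t < T) (scale i.+1 <
    `|scale_learner i.+1 (history x y t) (x t) - y t|)%R <= mistake_budget i)%N.
  have [e e_ok] := half_scale_cover i a w a1 w1.
  apply: (halving_mistakes _ _ _ _ e); last by rewrite card_grid_params.
  by move=> t t_lt; rewrite yE // e_ok ?x1.
have := combine_loss scale_learner scale scale_ge0 x y mistake_budget T budget_ok.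
move/le_trans; apply.
have -> : scale 0 = 2^-1 ^+ l by rewrite /scale addn0.
rewrite /scale_learner conservative_cum [leRHS]addrA; apply: lerD; first apply: lerD.
- apply: ler_wpM2l => //; apply: (le_trans _ (conservative_bound_le k l l_gt0 k_le)).
  apply: (conservative_state_bound d k _ _ _ k_gt0 _ _ _ _ a w _ a1 w1).
  + by rewrite addn3.
  + exact: halfX_gt0.
  + rewrite ler_pdivlMr ?mulr_gt0 ?ltr0n //.
    rewrite (mulnC 2 l) exprD exprM (_ : 2^-1 ^+ 3 = 8^-1); last by field.
    rewrite [leLHS](_ : _ = 2^-1 ^+ l * (2^-1 ^+ l * k%:R)); last first.
      by move: (2^-1 ^+ l) => u; field.
    apply: ler_piMr; first by rewrite ltW ?halfX_gt0.
    by rewrite exprVn mulrC ler_pdivrMr // mul1r.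
  + exact: conservative_bound_lt.
  move=> p /List.in_map_iff[t [<- t_in]] /=.
  have t_lt : (t < T)%N.
    suff : t \in iota 0 T by rewrite mem_iota.
    elim: (iota 0 T) t_in => //= n s IH [->|/IH]; rewrite inE ?eqxx // => ->.
    by rewrite orbT.
  by split; [exact: x1 | exact: yE].
- apply: le_trans (ler_sum _ (fun (j : 'I_T) _ => budget_le j)) _.
  by rewrite -mulr_sumr; apply: ler_wpM2l => //; exact: sum_halfX.
apply: (le_trans _ (sum_halfX T)); apply: ler_sum => t _; exact: scale_sqr_le.
Qed.

End MultiscaleLearner.

Theorem theorem1p6 (R : realType) :
  exists C : R, 0 < C /\
  forall d k : nat, (1 <= d)%N -> (1 <= k)%N ->
    (Donl (@Hkd R k d) <= (C * @bound R k d)%:E)%E /\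
    exists L : @learner R d,
      forall (x : nat -> vec R d) (y : nat -> R) (T : nat),
        realizable_seq (@Hkd R k d) x y T ->
        cum_sq_loss L x y T <= C * @bound R k d.
Proof.
(* Exceeds [4 * 125 * 2 ^+ 15 * 8 + 130], where 8 comes from cubing [l <= 2 * lam]. *)
exists (2 ^+ 28); split=> [|d k d_gt0 k_gt0]; first exact: exprn_gt0.
have [l [l_gt0 dk_le l_lam]] := @scale_exists R d k d_gt0 k_gt0.
have loss (x : nat -> vec R d) (y : nat -> R) (T : nat) :
    realizable_seq (@Hkd R k d) x y T ->
    cum_sq_loss (multiscale d k l) x y T <= 2 ^+ 28 * @bound R k d.
  move=> /(multiscale_loss d k l d_gt0 k_gt0 l_gt0 dk_le)/le_trans; apply.
  have k1 : 1 <= k%:R :> R by rewrite ler1n.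
  have lam1 : 1 <= ln (expR 1 * d%:R * k%:R) :> R.
    rewrite -ler_expR lnK ?posrE ?mulr_gt0 ?expR_gt0 ?ltr0n //.
    by rewrite -mulrA -natrM ler_peMr ?expR_ge0 // ler1n muln_gt0 d_gt0.
  rewrite /bound; move: (ln _) l_lam lam1 => lam l_lam lam1.
  (* The argument yields the cube of the logarithm; [lam >= 1] raises it to the fourth power. *)
  have l3 : l%:R ^+ 3 <= 8 * lam ^+ 4.
    apply: le_trans (_ : (2 * lam) ^+ 3 <= _).
      by rewrite lerXn2r ?nnegrE //; lra.
    rewrite (_ : (2 * lam) ^+ 3 = 8 * lam ^+ 3); last by ring.
    by apply: ler_wpM2l => //; exact: ler_weXn2l.
  have k2 : 1 <= k%:R ^+ 2 :> R by rewrite exprn_ege1.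
  have lam4 : 1 <= lam ^+ 4 by rewrite exprn_ege1.
  have kl := ler_wpM2l (le_trans ler01 k2) l3.
  have one : 1 <= k%:R ^+ 2 * lam ^+ 4 by exact: mulr_ege1.
  move: kl one; rewrite [leRHS]mulrCA.
  rewrite -(mulrA (125 * 2 ^+ 15)).
  move: (k%:R ^+ 2 * lam ^+ 4) (k%:R ^+ 2 * l%:R ^+ 3) => u v; lra.
split; last by exists (multiscale d k l).
exact: Donl_le_learner loss.
Qed.
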